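(* The Baumslag-Solitar group $B(1,2)=\langle a,b\mid bab^{-1}=a^2\rangle$ admits exactly four $C$-orderings.
   Context: A left-ordering on a group $G$ is a left-invariant total order $\preceq$ on $G$. An element $g$ is positive if $g\succ id$. A left-ordering $\preceq$ is Conradian (a $C$-ordering) if for all positive $f,g\in G$ there is $n\in\mathbb{N}=\{1,2,\ldots\}$ with $fg^n\succ g$. *)

(* Defs.v *)
From HB Require Import structures.
From mathcomp Require Import all_boot.
From mathcomp Require Import boolp classical_sets functions cardinality.

Set Implicit Arguments.
Unset Strict Implicit.
Unset Printing Implicit Defensive.

Local Open Scope classical_set_scope.
Local Open Scope quotient_scope.
Local Open Scope group_scope.

(** Groups given by generators and relations *)

(* The letter (i, false) is the generator i, and (i, true) its formal inverse. *)
Definition word (I : Type) := seq (I * bool).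

Definition winv (I : Type) (u : word I) : word I :=
  rev [seq (x.1, ~~ x.2) | x <- u].

Section Presentation.
Variables (I : choiceType) (E : set (word I * word I)).

(* The smallest congruence on words which makes each letter cancel with its   *)
(* inverse and identifies u with v for each relation u = v, that is, each     *)
(* pair (u, v) in E.                                                          *)
Inductive pres_cong : word I -> word I -> Prop :=
| PresRel u v of E (u, v) : pres_cong u v
| PresCancel i c : pres_cong [:: (i, c); (i, ~~ c)] [::]
| PresRefl u : pres_cong u u
| PresSym u v of pres_cong u v : pres_cong v u
| PresTrans v u w of pres_cong u v & pres_cong v w : pres_cong u w
| PresCat u u' v v' of pres_cong u u' & pres_cong v v' :
    pres_cong (u ++ v) (u' ++ v').

Definition pres_rel : rel (word I) := fun u v => `[< pres_cong u v >].

Fact pres_rel_refl : reflexive pres_rel.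
Proof. by move=> u; apply/asboolP; exact: PresRefl. Qed.

Fact pres_rel_sym : symmetric pres_rel.
Proof. by move=> u v; apply/asboolP/asboolP; exact: PresSym. Qed.

Fact pres_rel_trans : transitive pres_rel.
Proof.
by move=> v u w /asboolP uv /asboolP vw; apply/asboolP; exact: PresTrans uv vw.
Qed.

Canonical pres_equiv := EquivRel pres_rel
  pres_rel_refl pres_rel_sym pres_rel_trans.

Definition presented := {eq_quot pres_equiv}.
HB.instance Definition _ := Choice.on presented.
HB.instance Definition _ := EqQuotient.on presented.

Definition pclass (u : word I) : presented := \pi_presented u.
Definition pmul (x y : presented) : presented := pclass (repr x ++ repr y).
Definition pone : presented := pclass [::].
Definition pinv (x : presented) : presented := pclass (winv (repr x)).

Lemma pclassP u v : pclass u = pclass v <-> pres_cong u v.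
Proof.
split=> [/eqmodP/asboolP //|uv].
by apply/eqmodP/asboolP.
Qed.

Lemma pclassK x : pclass (repr x) = x.
Proof. exact: reprK. Qed.

Lemma repr_pclass u : pres_cong (repr (pclass u)) u.
Proof. by apply/pclassP; rewrite pclassK. Qed.

Lemma pmulE u v : pmul (pclass u) (pclass v) = pclass (u ++ v).
Proof. by apply/pclassP/PresCat; exact: repr_pclass. Qed.

Lemma winvK : involutive (@winv I).
Proof.
move=> u; rewrite /winv map_rev revK -map_comp -[RHS]map_id.
by apply: eq_map => -[i c] /=; rewrite negbK.
Qed.

Lemma pres_cat_winv u : pres_cong (u ++ winv u) [::].
Proof.
elim: u => [|[i c] u IHu]; first exact: PresRefl.
rewrite /winv map_cons rev_cons -/(winv u) -cats1 /= catA -cat1s.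
apply: PresTrans (PresCancel i c); rewrite -[[:: _; _]]/([:: (i, c)] ++ _).
apply: PresCat; first exact: PresRefl.
by rewrite -[X in pres_cong _ X]cat0s; apply: PresCat IHu (PresRefl _).
Qed.

Lemma pres_winv_cat u : pres_cong (winv u ++ u) [::].
Proof. by rewrite -{2}[u]winvK; exact: pres_cat_winv. Qed.

Fact pmulA : associative pmul.
Proof.
move=> x y z; rewrite -[x]pclassK -[y]pclassK -[z]pclassK.
by rewrite !pmulE catA.
Qed.

Fact pmul1x : left_id pone pmul.
Proof. by move=> x; rewrite -[x]pclassK pmulE. Qed.

Fact pmulx1 : right_id pone pmul.
Proof. by move=> x; rewrite -[x]pclassK pmulE cats0. Qed.

Fact pmulVx : left_inverse pone pinv pmul.
Proof.
move=> x; rewrite /pinv -{2}[x]pclassK pmulE.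
by apply/pclassP; exact: pres_winv_cat.
Qed.

Fact pmulxV : right_inverse pone pinv pmul.
Proof.
move=> x; rewrite /pinv -{1}[x]pclassK pmulE.
by apply/pclassP; exact: pres_cat_winv.
Qed.

HB.instance Definition _ :=
  isGroup.Build presented pmulA pmul1x pmulx1 pmulVx pmulxV.

End Presentation.

(** The Baumslag-Solitar group B(1,2) *)

(* The generating set {a, b} is encoded as bool, with a = false, b = true. *)
Definition BS_a : word bool := [:: (false, false)].
Definition BS_b : word bool := [:: (true, false)].

Definition BS12 : groupType :=
  presented [set (BS_b ++ BS_a ++ winv BS_b, BS_a ++ BS_a)].

(** Left-orderings and C-orderings *)

Section Orderings.
Variables (G : groupType) (R : rel G).

Definition left_ordering : Prop :=
  [/\ reflexive R, antisymmetric R, transitive R, total R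
    & forall h f g : G, R f g -> R (h * f) (h * g)].

Definition ord_lt (f g : G) : bool := (f != g) && R f g.

Definition ord_positive (g : G) : bool := ord_lt 1 g.

Definition C_ordering : Prop :=
  left_ordering /\
  forall f g : G, ord_positive f -> ord_positive g ->
    exists2 n : nat, (0 < n)%N & ord_lt g (f * g ^+ n).

End Orderings.

(* Main.v *)
Require Import Defs.
From mathcomp Require Import all_boot.
From mathcomp Require Import boolp classical_sets functions cardinality.
From mathcomp Require Import all_order all_algebra.
From mathcomp Require Import zify lra.

Set Implicit Arguments.
Unset Strict Implicit.
Unset Printing Implicit Defensive.

Import Order.TTheory GRing.Theory Num.Theory.

Local Open Scope classical_set_scope.
Local Open Scope card_scope.

(** B(1,2) acts faithfully on the rationals by affine maps, with a acting as
t |-> t + 1 and b as t |-> 2 t. So an element is a pair (slope, shift): the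
slope is a power of 2, and the kernel of the slope is the group of
translations, which is Z[1/2] with b acting on it by doubling.

Comparing first the slopes and then the shifts, each either increasingly or
decreasingly, gives four left-orderings. They are C-orderings, with exponent
n = 2 always sufficient ([lex_order_C]), and they are told apart by the signs
of a and b.

Conversely, the point is that in a C-ordering the translations are
infinitely small with respect to every element of slope other than 1. If h is
positive and conjugation by h, or by its inverse, sends x to x^m with m > 1,
then x < h ([contraction_dominates], [dilation_dominates]). Left-orderings
that violate this do exist: for instance, those induced by the affine action
through the orbit of an irrational base point. There two suitable contractions,
whose fixed points lie on the same side of the base point, violate the Conrad
property, and the proof of [contraction_dominates] is the algebraic version of
this. Consequently, multiplying an element of slope other than 1 by a
translation does not change its sign ([pos_mul_scaled]), so that this sign
depends only on the slope and on the sign of b. The sign of a translation is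
determined by the sign of a, because a suitable power of it is conjugate to a
power of a. Thus the signs of a and b determine the C-ordering
([C_ordering_lex]). Faithfulness and this last argument both rest on the
normal form b^-n a^p a^-q b^l ([BS_normal_form]). *)

(** * Positive elements of a left-ordered group *)

Section LeftOrder.
Local Open Scope group_scope.
Variables (G : groupType) (R : rel G).
Hypothesis RO : left_ordering R.

Local Notation lt := (ord_lt R).
Local Notation pos := (ord_positive R).

Lemma lo_refl x : R x x. Proof. by case: RO. Qed.

Lemma lo_anti x y : R x y -> R y x -> x = y.
Proof. by case: RO => _ anti _ _ _ xy yx; apply: anti; rewrite xy. Qed.

Lemma lo_trans y x z : R x y -> R y z -> R x z.
Proof. by case: RO => _ _ trans _ _; exact: trans. Qed.

Lemma lo_total x y : R x y \/ R y x.
Proof. by case: RO => _ _ _ total _; exact/orP. Qed.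

Lemma lo_mul h x y : R (h * x) (h * y) = R x y.
Proof.
case: RO => _ _ _ _ lmul; apply/idP/idP; last exact: lmul.
by move/(lmul h^-1); rewrite !mulKg.
Qed.

Lemma lt_mul h x y : lt (h * x) (h * y) = lt x y.
Proof. by rewrite /ord_lt lo_mul (inj_eq (mulgI h)). Qed.

Lemma lt_le x y : lt x y -> R x y.
Proof. by rewrite /ord_lt => /andP[]. Qed.

Lemma lt_le_trans y x z : lt x y -> R y z -> lt x z.
Proof.
rewrite {1}/ord_lt => /andP[xNy xy] yz; rewrite /ord_lt (lo_trans xy yz) andbT.
by apply: contra xNy => /eqP xz; rewrite (lo_anti xy) // xz.
Qed.

Lemma le_lt_trans y x z : R x y -> lt y z -> lt x z.
Proof.
rewrite {1}/ord_lt => xy /andP[yNz yz]; rewrite /ord_lt (lo_trans xy yz) andbT.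
by apply: contra yNz => /eqP xz; rewrite (lo_anti yz) // -xz.
Qed.

Lemma lt_nle x y : lt x y = ~~ R y x.
Proof.
apply/idP/idP => [|Nyx].
  rewrite /ord_lt => /andP[xNy xy]; apply: contra xNy => yx.
  exact/eqP/lo_anti.
case: (lo_total x y) => [xy|yx]; last by rewrite yx in Nyx.
by rewrite /ord_lt xy andbT; apply: contra Nyx => /eqP->; exact: lo_refl.
Qed.

Lemma lt_pos x y : lt x y = pos (x^-1 * y).
Proof. by rewrite /ord_positive -(lt_mul x^-1) mulVg. Qed.

Lemma pos_total x : x != 1 -> pos x \/ pos x^-1.
Proof.
move=> xN1; case: (lo_total 1 x) => [le1x|lex1]; [left|right].
  by rewrite /ord_positive /ord_lt eq_sym xN1.
by rewrite -[x^-1]mulg1 -lt_pos /ord_lt xN1.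
Qed.

Lemma posN x : pos x^-1 -> ~~ pos x.
Proof.
by rewrite -[x^-1]mulg1 -lt_pos /ord_positive [lt 1 x]lt_nle negbK; exact: lt_le.
Qed.

Lemma pos_mul x y : pos x -> pos y -> pos (x * y).
Proof.
move=> px py; apply: lt_le_trans px _; apply: lt_le.
by rewrite -[X in lt X _]mulg1 lt_mul.
Qed.

Lemma pos_exp x n : (0 < n)%N -> pos x -> pos (x ^+ n).
Proof.
case: n => // n _ px; elim: n => [|n IHn]; first by rewrite expg1.
by rewrite expgS; exact: pos_mul.
Qed.

Lemma pos_exp_inv x n : pos (x ^+ n) -> pos x.
Proof.
case: n => [|n] pxn; first by rewrite /ord_positive /ord_lt eqxx in pxn.
have [x1|xN1] := eqVneq x 1.
  by rewrite x1 expg1n /ord_positive /ord_lt eqxx in pxn.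
case: (pos_total xN1) => // /(@pos_exp _ n.+1 isT).
by rewrite expVgn => /posN; rewrite pxn.
Qed.

Lemma le_exp x m n : pos x -> (m <= n)%N -> R (x ^+ m) (x ^+ n).
Proof.
move=> px /subnKC <-; rewrite expgnDr -[X in R X _]mulg1 lo_mul.
case: (n - m)%N => [|k]; first exact: lo_refl.
exact/lt_le/pos_exp.
Qed.

End LeftOrder.

(** * Elements scaled by conjugation in a C-ordered group *)

Section Conradian.
Local Open Scope group_scope.
Variables (G : groupType) (R : rel G).
Hypothesis CO : C_ordering R.

Local Notation lt := (ord_lt R).
Local Notation pos := (ord_positive R).

Let RO : left_ordering R. Proof. by case: CO. Qed.

(** Think of x as the translation by 1 and of h as a contraction of ratio 1/m.
If h <= x, then g = x^(m^2) h and f = x^-(m^2+m) g^2 are contractions that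
move the base point up, and all the f g^n keep it below its image under g,
since the powers of g stay bounded by a power of x. This contradicts the
Conrad property of f and g. *)
Lemma contraction_dominates (h x : G) m :
  (1 < m)%N -> x ^ h = x ^+ m -> pos x -> pos h -> lt x h.
Proof.
move=> m_gt1 xh px ph; rewrite lt_nle //; apply/negP => le_hx.
have hxE k : h * x ^+ (m * k) = x ^+ k * h.
  by rewrite expgnA -xh -conjXg -conjgC.
pose g := x ^+ (m * m) * h; pose f := x ^- (m * m + m) * (g * g).
have pxn k : R 1 (x ^+ k) by rewrite -(expg0 x); apply: le_exp.
have pg : pos g.
  apply: (le_lt_trans RO (pxn (m * m)%N)).
  by rewrite /g -[X in lt X _]mulg1 lt_mul.
have pf : pos f.
  rewrite /f -lt_pos // /g !mulgA -(mulgA (x ^+ _) h) hxE mulgA -expgnDr.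
  rewrite -[X in lt X _]mulg1 -mulgA lt_mul //.
  exact: pos_mul.
(* The bound x^(2m^2+m) reproduces itself under left multiplication by g: its *)
(* exponent is m (2m+1), so moving h across it leaves x^(m^2+2m+1) h, at most  *)
(* x^(m^2+2m+2), and m^2+2m+2 <= 2m^2+m as soon as m >= 2.                     *)
have gX n : R (g ^+ n) (x ^+ (2 * (m * m) + m)).
  elim: n => [|n IHn]; first by rewrite expg0.
  rewrite expgS; apply: (@lo_trans _ _ RO (g * x ^+ (2 * (m * m) + m))).
    by rewrite lo_mul.
  have -> : (2 * (m * m) + m = m * (2 * m + 1))%N by lia.
  rewrite /g -mulgA hxE mulgA -expgnDr.
  apply: (@lo_trans _ _ RO (x ^+ (m * m + (2 * m + 1)) * x)); first by rewrite lo_mul.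
  by rewrite -expgSr; apply: le_exp => //; nia.
case: CO => _ /(_ f g pf pg)[n _]; rewrite lt_nle // => /negP; apply.
apply: (@lo_trans _ _ RO (x ^+ (m * m))).
  rewrite /f -mulgA -mulgA -!expgS.
  rewrite -(lo_mul RO (x ^+ (m * m + m))) mulVKg -expgnDr.
  have -> : (m * m + m + m * m = 2 * (m * m) + m)%N by lia.
  exact: gX.
by apply: lt_le; rewrite -[X in lt X _]mulg1 lt_mul.
Qed.

(** If h <= x, then x h^-1 is positive and contracts x, so it is greater than x
by [contraction_dominates]; hence h^-1 is positive, which is absurd. *)
Lemma dilation_dominates (h x : G) m :
  (1 < m)%N -> x ^ h^-1 = x ^+ m -> pos x -> pos h -> lt x h.
Proof.
move=> m_gt1 xh px ph; rewrite lt_nle //; apply/negP => le_hx.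
have pxh : pos (x * h^-1).
  rewrite conjgC xh -(subnKC m_gt1) addSn addSn expgS mulgA.
  apply: (@le_lt_trans _ _ RO (h^-1 * x)).
    by rewrite -(lo_mul RO h) mulg1 mulVKg.
  by rewrite -[X in lt X _]mulg1 lt_mul //; exact: pos_exp.
have xxh : x ^ (x * h^-1) = x ^+ m by rewrite conjgM [x ^ x]conjgE mulKg.
have := contraction_dominates m_gt1 xxh px pxh.
by rewrite -[X in lt X _]mulg1 lt_mul // => /(posN RO); rewrite ph.
Qed.

(** The inverse of x is scaled by h as well, so h exceeds it whatever the sign
of x. *)
Lemma pos_mul_scaled (h x : G) m :
  (1 < m)%N -> x ^ h = x ^+ m \/ x ^ h^-1 = x ^+ m -> pos h -> pos (x * h).
Proof.
move=> m_gt1 xh ph; have [->|xN1] := eqVneq x 1; first by rewrite mul1g.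
case: (pos_total RO xN1) => [px|pVx]; first exact: pos_mul.
rewrite -[x]invgK -lt_pos //; case: xh => xh.
  by apply: (contraction_dominates m_gt1) => //; rewrite conjVg xh expVgn.
by apply: (dilation_dominates m_gt1) => //; rewrite conjVg xh expVgn.
Qed.

End Conradian.

(** * The affine action of B(1,2) on the rationals *)

Section AffineAction.
Local Open Scope ring_scope.

Definition letter_act (x : bool * bool) (t : rat) : rat :=
  match x with
  | (false, false) => t + 1
  | (false, true) => t - 1
  | (true, false) => 2 * t
  | (true, true) => t / 2
  end.

Definition word_act (w : word bool) (t : rat) : rat := foldr letter_act t w.

Lemma word_act_cat u v t : word_act (u ++ v) t = word_act u (word_act v t).
Proof. by rewrite /word_act foldr_cat. Qed.

Lemma word_act_affine w :
  exists2 s, 0 < s & forall t, word_act w t = s * t + word_act w 0.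
Proof.
elim: w => [|x w [s s_gt0 IHw]]; first by exists 1 => // t; rewrite mul1r addr0.
case: x => -[] [] /=; [exists (s / 2)|exists (2 * s)|exists s|exists s];
  try (by []); try lra; by move=> t; rewrite IHw; lra.
Qed.

Definition BS_act (g : BS12) : rat -> rat := word_act (repr g).
Definition shift (g : BS12) : rat := BS_act g 0.
(** The linear coefficient of the affine map of g, recovered from two values. *)
Definition slope (g : BS12) : rat := BS_act g 1 - BS_act g 0.

Let rels : set (word bool * word bool) :=
  [set (BS_b ++ BS_a ++ winv BS_b, BS_a ++ BS_a)]%classic.

Lemma word_act_cong u v : pres_cong rels u v -> word_act u =1 word_act v.
Proof.
elim=> {u v} [u v uvE|i c|u|u v _ IH|u v w _ uv _ vw|u u' v v' _ IHu _ IHv] t //.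
- by case: uvE => -> ->; rewrite /word_act /=; lra.
- by case: i c => -[]; rewrite /word_act /=; lra.
- by rewrite uv.
- by rewrite !word_act_cat IHu IHv.
Qed.

Lemma BS_act_class w : BS_act (pclass rels w) =1 word_act w.
Proof. exact/word_act_cong/repr_pclass. Qed.

Lemma BS_actM g h t : BS_act (g * h)%g t = BS_act g (BS_act h t).
Proof.
by rewrite -[X in BS_act X]/(pclass rels (repr g ++ repr h)) BS_act_class
  word_act_cat.
Qed.

Lemma BS_actE g t : BS_act g t = slope g * t + shift g.
Proof.
rewrite /slope /shift /BS_act; have [s _ E] := word_act_affine (repr g).
by rewrite (E t) (E 1); lra.
Qed.

Lemma slope_gt0 g : 0 < slope g.
Proof.
rewrite /slope /BS_act; have [s s_gt0 E] := word_act_affine (repr g).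
by rewrite (E 1) mulr1 addrK.
Qed.

Lemma slopeM g h : slope (g * h)%g = slope g * slope h.
Proof. by rewrite {1}/slope !BS_actM !BS_actE; lra. Qed.

Lemma shiftM g h : shift (g * h)%g = shift g + slope g * shift h.
Proof. by rewrite {1}/shift BS_actM !BS_actE; lra. Qed.

Lemma slope1 : slope 1%g = 1.
Proof. by rewrite /slope !BS_act_class /word_act /=; lra. Qed.

Lemma shift1 : shift 1%g = 0.
Proof. by rewrite /shift BS_act_class. Qed.

Lemma slopeV g : slope g^-1%g = (slope g)^-1.
Proof.
by apply: (mulrI (unitf_gt0 (slope_gt0 g)));
  rewrite -slopeM mulgV slope1 divff ?gt_eqF ?slope_gt0.
Qed.

Lemma shiftV g : shift g^-1%g = - (slope g)^-1 * shift g.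
Proof.
have := shiftM g^-1%g g; rewrite mulVg shift1 slopeV => /esym/eqP.
by rewrite addr_eq0 mulNr => /eqP.
Qed.

Lemma slopeX g n : slope (g ^+ n)%g = slope g ^+ n.
Proof.
elim: n => [|n IHn]; first by rewrite expg0 slope1 expr0.
by rewrite expgS slopeM IHn exprS.
Qed.

Lemma shiftX1 g n : slope g = 1 -> shift (g ^+ n)%g = shift g *+ n.
Proof.
move=> g1; elim: n => [|n IHn]; first by rewrite expg0 shift1 mulr0n.
by rewrite expgS shiftM IHn g1 mul1r mulrS.
Qed.

Lemma shiftX0 g n : shift g = 0 -> shift (g ^+ n)%g = 0.
Proof.
move=> g0; elim: n => [|n IHn]; first by rewrite expg0 shift1.
by rewrite expgS shiftM IHn g0 mulr0 addr0.
Qed.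

Definition gen_a : BS12 := pclass rels BS_a.
Definition gen_b : BS12 := pclass rels BS_b.

Lemma slope_a : slope gen_a = 1.
Proof. by rewrite /slope !BS_act_class /word_act /=; lra. Qed.
Lemma shift_a : shift gen_a = 1.
Proof. by rewrite /shift BS_act_class. Qed.
Lemma slope_b : slope gen_b = 2.
Proof. by rewrite /slope !BS_act_class /word_act /=; lra. Qed.
Lemma shift_b : shift gen_b = 0.
Proof. by rewrite /shift BS_act_class. Qed.

End AffineAction.

(** * Normal form and faithfulness of the affine action *)

Section NormalForm.
Local Open Scope group_scope.

Local Notation a := gen_a.
Local Notation b := gen_b.

Lemma pclassM (I : choiceType) (E : set (word I * word I)) u v :
  pclass E (u ++ v) = pclass E u * pclass E v.
Proof. exact/esym/pmulE. Qed.

Lemma pclass_winv (I : choiceType) (E : set (word I * word I)) w :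
  pclass E (winv w) = (pclass E w)^-1.
Proof.
apply/esym/mulg1_eq.
by rewrite -pclassM; apply/pclassP; exact: pres_cat_winv.
Qed.

Lemma BS_relation : a ^ b^-1 = a ^+ 2.
Proof.
rewrite conjgE invgK expg2 /gen_a /gen_b -pclass_winv.
rewrite -(pclassM _ BS_a (winv _)) -(pclassM _ BS_b) -(pclassM _ BS_a BS_a).
by apply/pclassP/PresRel.
Qed.

(** The element acting as the translation by (p - q) / 2^n. The difference of
two natural numbers stands for an integer exponent of a. *)
Definition translation n p q : BS12 := (a ^+ p * a ^- q) ^ (b ^+ n).

Lemma translation_conjVb n p q : translation n p q ^ b^-1 = translation n p q ^+ 2.
Proof.
rewrite /translation -conjgM.
have -> : b ^+ n * b^-1 = b^-1 * b ^+ n.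
  by apply: commuteV; apply: commute_sym; exact: commuteX.
rewrite conjgM -conjXg; congr (_ ^ _).
rewrite conjMg conjVg !conjXg BS_relation [RHS]expgMn.
  by rewrite expVgn -!expgnA mulnC [(2 * q)%N]mulnC.
by apply: commuteV; apply: commuteX2.
Qed.

Lemma translation_conjVbX n p q k :
  translation n p q ^ (b ^- k) = translation n p q ^+ (2 ^ k).
Proof.
elim: k => [|k IHk]; first by rewrite expg0 invg1 conjg1.
rewrite expgS invgM conjgM IHk conjXg translation_conjVb -expgnA.
by rewrite expnS.
Qed.

Lemma BS_word_ind (P : BS12 -> Prop) :
  P 1 -> (forall g, P g -> P (a * g)) -> (forall g, P g -> P (a^-1 * g)) ->
  (forall g, P g -> P (b * g)) -> (forall g, P g -> P (b^-1 * g)) ->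
  forall g, P g.
Proof.
move=> P1 Pa PVa Pb PVb g; rewrite -[g]pclassK.
elim: (repr g) => [//|[i c] w Pw].
rewrite -cat1s pclassM.
case: i c => -[].
- by have := PVb _ Pw; rewrite /gen_b -pclass_winv.
- exact: Pb.
- by have := PVa _ Pw; rewrite /gen_a -pclass_winv.
- exact: Pa.
Qed.

Lemma a_conjVbX n : a ^ (b ^- n) = a ^+ (2 ^ n).
Proof.
elim: n => [|n IHn]; first by rewrite expg0 invg1 conjg1.
by rewrite expgS invgM conjgM IHn conjXg BS_relation -expgnA -expnS.
Qed.

(** The elements of this form are closed under left multiplication by the letters: a
becomes a^(2^n) when it passes b^-n, and b either cancels against b^-n or, if n = 0,
passes through the powers of a by doubling their exponents. *)
Lemma BS_normal_form g :
  exists n p q l, g = b ^- n * (a ^+ p * a ^- q) * b ^+ l.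
Proof.
have aVb n : a * b ^- n = b ^- n * a ^+ (2 ^ n) by rewrite -a_conjVbX conjgC.
have aVVb n : a^-1 * b ^- n = b ^- n * a ^- (2 ^ n).
  by rewrite -a_conjVbX -conjVg conjgC.
elim/BS_word_ind: g => [|_ [n [p [q [l ->]]]]|_ [n [p [q [l ->]]]]|
                       _ [n [p [q [l ->]]]]|_ [n [p [q [l ->]]]]].
- by exists 0%N, 0%N, 0%N, 0%N; rewrite !expg0 invg1 !mulg1.
- by exists n, (2 ^ n + p)%N, q, l; rewrite expgnDr !mulgA aVb.
- exists n, p, (q + 2 ^ n)%N, l.
  rewrite expgnDr invgM !mulgA aVVb -!mulgA; congr (_ * _).
  rewrite !mulgA; congr (_ * _ * _).
  by apply/esym; apply: commuteV; apply: commute_sym; apply: commuteX2.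
- case: n => [|n].
    exists 0%N, (2 * p)%N, (2 * q)%N, l.+1.
    rewrite expg0 invg1 !mul1g expgS !mulgA; congr (_ * _).
    rewrite 2!expgnA -BS_relation -!conjXg -conjVg -conjMg -conjgCV.
    by rewrite mulgA.
  by exists n, p, q, l; rewrite expgSr invgM !mulgA mulgV mul1g.
- by exists n.+1, p, q, l; rewrite expgSr invgM !mulgA.
Qed.

Lemma BS_decomposition g :
  exists n p q l, g = translation n p q * (b ^- n * b ^+ l).
Proof.
have [n [p [q [l ->]]]] := BS_normal_form g; exists n, p, q, l.
by rewrite /translation conjgE !mulgA mulgK.
Qed.

Lemma slopeJ g h : slope (g ^ h) = slope g.
Proof.
by rewrite conjgE !slopeM slopeV mulrCA mulVf ?mulr1 ?gt_eqF ?slope_gt0.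
Qed.

Lemma shiftJ g h : slope g = 1%R -> shift (g ^ h) = (shift g / slope h)%R.
Proof. by move=> g1; rewrite conjgE !shiftM shiftV slopeV g1; lra. Qed.

Lemma slope_power_a p q : slope (a ^+ p * a ^- q) = 1%R.
Proof. by rewrite slopeM slopeV !slopeX slope_a !expr1n divr1. Qed.

Lemma shift_power_a p q : shift (a ^+ p * a ^- q) = (p%:R - q%:R)%R.
Proof.
rewrite shiftM shiftV slopeX !shiftX1 ?slope_a // shift_a slopeX slope_a.
by rewrite !expr1n invr1 mul1r mulN1r.
Qed.

Lemma slope_translation n p q : slope (translation n p q) = 1%R.
Proof. by rewrite slopeJ slope_power_a. Qed.

Lemma shift_translation n p q :
  shift (translation n p q) = ((p%:R - q%:R) / 2 ^+ n)%R.
Proof. by rewrite shiftJ ?slope_power_a // shift_power_a slopeX slope_b. Qed.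

Lemma slope_bVb n l : slope (b ^- n * b ^+ l) = (2 ^+ l / 2 ^+ n)%R.
Proof. by rewrite slopeM slopeV !slopeX slope_b mulrC. Qed.

Lemma shift_bVb n l : shift (b ^- n * b ^+ l) = 0%R.
Proof. by rewrite shiftM shiftV !(shiftX0 _ shift_b) !mulr0 addr0. Qed.

(** Faithfulness of the affine action: an element in normal form has slope
2^(l-n) and shift (p-q) / 2^n, so it acts trivially only if l = n and p = q. *)
Lemma slope_shift_inj g h : slope g = slope h -> shift g = shift h -> g = h.
Proof.
move=> sl sh; apply: divg1_eq.
have {sl sh} [] : slope (g / h) = 1%R /\ shift (g / h) = 0%R.
  rewrite slopeM shiftM slopeV shiftV sl sh.
  have h_neq0 : slope h != 0%R by rewrite gt_eqF ?slope_gt0.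
  by rewrite mulrA mulrN divff // mulN1r subrr.
have [n [p [q [l ->]]]] := BS_decomposition (g / h).
rewrite slopeM shiftM slope_bVb shift_bVb slope_translation shift_translation.
rewrite mulr0 addr0 mul1r => sl /eqP sh.
have /eqP : (2 ^+ l = 2 ^+ n :> rat)%R by apply: divr1_eq.
rewrite -!natrX eqr_nat eqn_exp2l // => /eqP ->.
move: sh; rewrite mulf_eq0 invr_eq0 expf_eq0 andbF orbF subr_eq0 eqr_nat.
by move=> /eqP ->; rewrite /translation mulgV conj1g mul1g mulVg.
Qed.

End NormalForm.

(** * The four lexicographic orderings *)

Section FourOrders.
Local Open Scope ring_scope.

Definition signed (e : bool) (t : rat) : rat := if e then - t else t.

Definition lex_order (eb ea : bool) : rel BS12 := fun f g =>
  (signed eb (slope f) < signed eb (slope g))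
  || (slope f == slope g) && (signed ea (shift f) <= signed ea (shift g)).

Lemma lt_signedM e s x y :
  0 < s -> (signed e (s * x) < signed e (s * y)) = (signed e x < signed e y).
Proof. by case: e => s_gt0 /=; rewrite ?ltrN2 ltr_pM2l. Qed.

Lemma le_signed_affine e s t x y :
  0 < s ->
  (signed e (t + s * x) <= signed e (t + s * y)) = (signed e x <= signed e y).
Proof. by case: e => s_gt0 /=; rewrite ?lerN2 lerD2l ler_pM2l. Qed.

Lemma signed_inj e : injective (signed e).
Proof. by case: e => //; exact: oppr_inj. Qed.

Lemma lex_order_mul eb ea h f g :
  lex_order eb ea (h * f)%g (h * g)%g = lex_order eb ea f g.
Proof.
rewrite /lex_order !slopeM !shiftM lt_signedM ?slope_gt0 //.
have h_neq0 : slope h != 0 by rewrite gt_eqF ?slope_gt0.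
by rewrite (inj_eq (mulfI h_neq0)) le_signed_affine ?slope_gt0.
Qed.

Lemma lex_order_left eb ea : left_ordering (lex_order eb ea).
Proof.
split.
- by move=> f; rewrite /lex_order eqxx lexx orbT.
- move=> f g /andP[/orP[lt1|/andP[/eqP sl le1]] /orP[lt2|/andP[/eqP sl2 le2]]].
  + by have := lt_trans lt1 lt2; rewrite ltxx.
  + by rewrite sl2 ltxx in lt1.
  + by rewrite sl ltxx in lt2.
  + apply: slope_shift_inj => //; apply: (@signed_inj ea).
    by apply/eqP; rewrite eq_le le1.
- move=> g f h /orP[lt1|/andP[/eqP sl le1]] /orP[lt2|/andP[/eqP sl2 le2]].
  + by rewrite /lex_order (lt_trans lt1 lt2).
  + by rewrite /lex_order -sl2 lt1.
  + by rewrite /lex_order sl lt2.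
  + by rewrite /lex_order sl sl2 eqxx (le_trans le1 le2) orbT.
- move=> f g; rewrite /lex_order [slope g == _]eq_sym -(inj_eq (@signed_inj eb)).
  by case: ltgtP => //= _; exact: le_total.
- by move=> h f g; rewrite lex_order_mul.
Qed.

Lemma lex_order_pos eb ea g :
  ord_positive (lex_order eb ea) g =
  (signed eb 1 < signed eb (slope g)) || (slope g == 1) && (0 < signed ea (shift g)).
Proof.
rewrite /ord_positive lt_nle; last exact: lex_order_left.
rewrite /lex_order slope1 shift1 negb_or negb_and.
rewrite -(inj_eq (@signed_inj eb)) eq_sym; case: ltgtP => //= _.
by rewrite -ltNge; case: ea => /=; rewrite ?oppr0.
Qed.

(** The element g^-1 f g^2 has slope r s, where r and s are the slopes of f and
g. Either r s is already beyond 1 in the chosen direction, or r = s = 1 and all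
three elements are translations, whose shifts add up. *)
Lemma lex_order_C eb ea : C_ordering (lex_order eb ea).
Proof.
split=> [|f g]; first exact: lex_order_left.
rewrite !lex_order_pos => pf pg; exists 2%N => //.
rewrite lt_pos; last exact: lex_order_left.
rewrite lex_order_pos expg2 !(slopeM, shiftM, slopeV, shiftV).
have g_gt0 := slope_gt0 g; have f_gt0 := slope_gt0 f.
set s := slope g in pg g_gt0 *; set r := slope f in pf f_gt0 *.
have -> : s^-1 * (r * (s * s)) = r * s by rewrite mulrCA mulKf ?gt_eqF.
case/orP: pg => [sl|/andP[/eqP sl sh]].
  apply/orP; left; case: eb sl pf => /= sl /orP[rl|/andP[/eqP rl _]]; nra.
rewrite sl mulr1 !mul1r.
case/orP: pf => [-> //|/andP[/eqP -> sh']]; apply/orP; right.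
by rewrite eqxx /=; case: ea sh sh' => /= sh sh'; rewrite invr1; lra.
Qed.

Lemma lex_order_b eb ea : lex_order eb ea 1%g gen_b = ~~ eb.
Proof. by rewrite /lex_order slope1 slope_b; case: eb. Qed.

Lemma lex_order_a eb ea : lex_order eb ea 1%g gen_a = ~~ ea.
Proof. by rewrite /lex_order slope1 slope_a shift1 shift_a; case: eb; case: ea. Qed.

Lemma lex_order_inj eb ea eb' ea' :
  lex_order eb ea = lex_order eb' ea' -> (eb, ea) = (eb', ea').
Proof.
move=> E; have := lex_order_b eb ea; have := lex_order_a eb ea.
by rewrite E lex_order_a lex_order_b => /negb_inj-> /negb_inj->.
Qed.

End FourOrders.

(** * The signs of the generators determine a C-ordering *)

Section Uniqueness.
Local Open Scope group_scope.

Local Notation a := gen_a.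
Local Notation b := gen_b.

Lemma pos_expgV_signed (G : groupType) (R : rel G) (x : G) :
  left_ordering R -> x != 1 ->
  forall p q : nat, (0 < signed (~~ R 1%g x) (p%:R - q%:R))%R ->
  ord_positive R (x ^+ p * x ^- q).
Proof.
move=> RO xN1 p q; case: (boolP (R 1 x)) => [R1x|NR1x] /=.
  rewrite subr_gt0 ltr_nat => ltqp; rewrite -expgnFr 1?ltnW //.
  by apply: pos_exp; rewrite ?subn_gt0 // /ord_positive /ord_lt eq_sym xN1.
rewrite opprB subr_gt0 ltr_nat => ltpq.
rewrite -invgF -expgnFr 1?ltnW // -expVgn; apply: pos_exp; rewrite ?subn_gt0 //.
by case: (pos_total RO xN1) => // /andP[_]; rewrite (negbTE NR1x).
Qed.

(** An element of slope 2^(l-n), with l and n distinct, is the product of a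
translation and a power of b, and b^(l-n) absorbs the translation by
[pos_mul_scaled]. If l = n, the element is a translation, and its power of
exponent 2^n is conjugate to a^(p-q). *)
Lemma lex_order_sub (R : rel BS12) : C_ordering R ->
  forall g, ord_positive (lex_order (~~ R 1 b) (~~ R 1 a)) g -> ord_positive R g.
Proof.
move=> CO g; have RO : left_ordering R by case: CO.
have bN1 : b != 1 by apply/eqP => /(congr1 slope); rewrite slope_b slope1.
have aN1 : a != 1 by apply/eqP => /(congr1 shift); rewrite shift_a shift1.
rewrite lex_order_pos; have [n [p [q [l ->]]]] := BS_decomposition g.
rewrite slopeM shiftM slope_translation shift_translation slope_bVb shift_bVb.
rewrite mulr0 addr0 mul1r.
have two_gt0 k : (0 < 2 ^+ k :> rat)%R by rewrite exprn_gt0.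
have bnl : b ^- n * b ^+ l = b ^+ l * b ^- n.
  by apply/esym; apply: commuteV; apply: commuteX2.
case/orP => [sl|/andP[/eqP/divr1_eq sl]].
  have : (0 < signed (~~ R 1%g b) (l%:R - n%:R : rat))%R.
    case: (R 1 b) sl => /=.
      by rewrite ltr_pdivlMr // mul1r ltr_eXn2l // subr_gt0 ltr_nat.
    by rewrite ltrN2 ltr_pdivrMr // mul1r ltr_eXn2l // opprB subr_gt0 ltr_nat.
  move=> /(pos_expgV_signed RO bN1); rewrite -bnl => pb.
  have nl : n <> l.
    by move=> nl; move: sl; rewrite nl divff ?ltxx // gt_eqF.
  have [ltnl|leln] := ltnP n l.
    apply: (@pos_mul_scaled _ _ CO _ _ (2 ^ (l - n))) => //.
      by rewrite -{1}(expn0 2) ltn_exp2l // subn_gt0.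
    by right; rewrite bnl -expgnFr 1?ltnW // translation_conjVbX.
  apply: (@pos_mul_scaled _ _ CO _ _ (2 ^ (n - l))) => //.
    by rewrite -{1}(expn0 2) ltn_exp2l // subn_gt0 ltn_neqAle leln andbT; apply/eqP/nesym.
  by left; rewrite bnl -invgF -expgnFr // translation_conjVbX.
have /eqP : (2 ^+ l = 2 ^+ n :> rat)%R by [].
rewrite -!natrX eqr_nat eqn_exp2l // => /eqP -> sh.
rewrite mulVg mulg1; apply: (@pos_exp_inv _ _ RO _ (2 ^ n)).
rewrite -translation_conjVbX /translation conjgK.
apply: pos_expgV_signed => //.
by case: (R 1 a) sh => /=; rewrite -?mulNr pmulr_lgt0 // invr_gt0 ltr0n expn_gt0.
Qed.

(** For total orderings, inclusion of the positive cones is enough for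
equality. *)
Lemma C_ordering_lex (R : rel BS12) : C_ordering R ->
  R = lex_order (~~ R 1 b) (~~ R 1 a).
Proof.
move=> CO; have RO : left_ordering R by case: CO.
set L := lex_order _ _; have LO : left_ordering L by exact: lex_order_left.
have ltLR f g : ord_lt L f g -> ord_lt R f g.
  by rewrite !lt_pos //; exact: lex_order_sub.
apply/funext => f; apply/funext => g; apply/idP/idP.
  by apply: contraTT; rewrite -!lt_nle //; exact: ltLR.
move=> Lfg; have [->|fNg] := eqVneq f g; first exact: lo_refl.
by apply/lt_le/ltLR; rewrite /ord_lt fNg.
Qed.

End Uniqueness.

Theorem proposition4p1 : [set R : rel BS12 | C_ordering R] #= `I_4.
Proof.
(* The two binary digits of n are the orientations of b and of a. *)
pose order_of n := lex_order (odd n) (odd n./2).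
have order_of_inj : {in `I_4 &, injective order_of}.
  move=> m n; rewrite !inE => m4 n4 /lex_order_inj.
  by case: m m4 => [|[|[|[|]]]] // _; case: n n4 => [|[|[|[|]]]].
suff -> : [set R : rel BS12 | C_ordering R] = order_of @` `I_4.
  exact: inj_card_eq.
apply/seteqP; split=> [R /= CO|_ [n _ <-]]; last exact: lex_order_C.
pose eb := ~~ R 1%g gen_b; pose ea := ~~ R 1%g gen_a.
exists (eb + ea.*2)%N; first by rewrite /=; case: eb ea => -[].
by rewrite [RHS]C_ordering_lex // -/eb -/ea; case: eb ea => -[].
Qed.
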